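(* Let $\mathcal{B}$ be a bicategory and $\mathfrak{W}$ a class of arrows of $\mathcal{B}$ satisfying conditions [WB1]--[WB5]. Let $\widehat{\mathfrak{W}}$ be the smallest class of arrows of $\mathcal{B}$ which contains $\mathfrak{W}$, is closed under composition, and is closed under invertible 2-cells. Then $\widehat{\mathfrak{W}}$ defines a wide subcategory which satisfies the conditions [BF1]--[BF5] for constructing a bicategory of fractions.
   Context: $gf$ is the composite of $f$ followed by $g$; $\alpha f$ and $g\alpha$ denote whiskerings; $(\beta)(\alpha)$ denotes vertical composition ($\alpha$ first); associativity and unit constraints are suppressed. Closed under invertible 2-cells: if $f\in\widehat{\mathfrak{W}}$ and there is an invertible 2-cell $f\Rightarrow g$, then $g\in\widehat{\mathfrak{W}}$. ''Wide subcategory'' means the class contains all identities and is closed under composition. **Conditions [WB1]--[WB5]** on a class $\mathfrak{W}$: [WB1] All identities are in $\mathfrak{W}$. [WB2] For composable $v\colon B\to C$, $w\colon C\to D$ in $\mathfrak{W}$ there is an arrow $u\colon A\to B$ with $wvu\in\mathfrak{W}$. [WB3] For $w\colon A\to B$ in $\mathfrak{W}$ and $f\colon C\to B$ there are $h\colon D\to A$, $v\colon D\to C$ with $v\in\mathfrak{W}$ and an invertible 2-cell $\alpha\colon wh\Rightarrow fv$. [WB4] For any 2-cell $\alpha\colon wf\Rightarrow wg$ with $w\in\mathfrak{W}$ there are $u\in\mathfrak{W}$ and a 2-cell $\beta\colon fu\Rightarrow gu$ with $\alpha u=w\beta$; and if $(u_1,\beta_1)$, $(u_2,\beta_2)$ are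 two such pairs, there are arrows $s,t$ with $u_1s,u_2t\in\mathfrak{W}$ and an invertible 2-cell $\varepsilon\colon u_1s\Rightarrow u_2t$ with $(g\varepsilon)(\beta_1s)=(\beta_2t)(f\varepsilon)$. [WB5] If $w\in\mathfrak{W}$ and there is an invertible 2-cell $v\Rightarrow w$, then $v\in\mathfrak{W}$. **Conditions [BF1]--[BF5]** on a class: [BF1] it contains all identities; [BF2] it is closed under composition; [BF3] is the same as [WB3]; [BF4] is [WB4] together with the requirement that, if the 2-cell $\alpha\colon wf\Rightarrow wg$ is invertible, there is a pair $(u,\beta)$ with $u$ in the class, $\alpha u=w\beta$ and $\beta$ invertible; [BF5] is the same as [WB5]. *)

(* Defs.v *)
Set Implicit Arguments.
Unset Strict Implicit.
Unset Printing Implicit Defensive.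

Declare Scope bicat_scope.
Delimit Scope bicat_scope with bicat.
Local Open Scope bicat_scope.

Reserved Notation "g ∘ f" (at level 40, left associativity).
Reserved Notation "β ∙ α" (at level 50, left associativity).
Reserved Notation "β ⋆ α" (at level 40, left associativity).
Reserved Notation "f ⇒ g" (at level 70, no associativity).

(** Bénabou's bicategories.  Both compositions are written in the applicative
    order: in [g ∘ f] and [β ∙ α] the right-hand factor comes first. *)
Record bicategory := Bicategory {
  ob :> Type;
  hom : ob -> ob -> Type;
  cell : forall A B : ob, hom A B -> hom A B -> Type
    where "f ⇒ g" := (cell f g);

  id2 : forall (A B : ob) (f : hom A B), f ⇒ f;
  vcomp : forall (A B : ob) (f g h : hom A B), g ⇒ h -> f ⇒ g -> f ⇒ h
    where "β ∙ α" := (vcomp β α);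
  vcomp_id_l : forall (A B : ob) (f g : hom A B) (α : f ⇒ g), id2 g ∙ α = α;
  vcomp_id_r : forall (A B : ob) (f g : hom A B) (α : f ⇒ g), α ∙ id2 f = α;
  vcomp_assoc : forall (A B : ob) (f g h k : hom A B)
      (γ : h ⇒ k) (β : g ⇒ h) (α : f ⇒ g), (γ ∙ β) ∙ α = γ ∙ (β ∙ α);

  id1 : forall A : ob, hom A A;
  comp : forall A B C : ob, hom B C -> hom A B -> hom A C
    where "g ∘ f" := (comp g f);
  hcomp : forall (A B C : ob) (g g' : hom B C) (f f' : hom A B),
      g ⇒ g' -> f ⇒ f' -> g ∘ f ⇒ g' ∘ f'
    where "β ⋆ α" := (hcomp β α);
  hcomp_id : forall (A B C : ob) (g : hom B C) (f : hom A B),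
      id2 g ⋆ id2 f = id2 (g ∘ f);
  interchange : forall (A B C : ob) (g g' g'' : hom B C) (f f' f'' : hom A B)
      (β' : g' ⇒ g'') (β : g ⇒ g') (α' : f' ⇒ f'') (α : f ⇒ f'),
      (β' ∙ β) ⋆ (α' ∙ α) = (β' ⋆ α') ∙ (β ⋆ α);

  assoc : forall (A B C D : ob) (h : hom C D) (g : hom B C) (f : hom A B),
      (h ∘ g) ∘ f ⇒ h ∘ (g ∘ f);
  assoc_inv : forall (A B C D : ob) (h : hom C D) (g : hom B C) (f : hom A B),
      h ∘ (g ∘ f) ⇒ (h ∘ g) ∘ f;
  assocK : forall (A B C D : ob) (h : hom C D) (g : hom B C) (f : hom A B),
      assoc_inv h g f ∙ assoc h g f = id2 _;
  assoc_invK : forall (A B C D : ob) (h : hom C D) (g : hom B C) (f : hom A B),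
      assoc h g f ∙ assoc_inv h g f = id2 _;
  assoc_natural : forall (A B C D : ob) (h h' : hom C D) (g g' : hom B C)
      (f f' : hom A B) (γ : h ⇒ h') (β : g ⇒ g') (α : f ⇒ f'),
      assoc h' g' f' ∙ ((γ ⋆ β) ⋆ α) = (γ ⋆ (β ⋆ α)) ∙ assoc h g f;

  lunit : forall (A B : ob) (f : hom A B), id1 B ∘ f ⇒ f;
  lunit_inv : forall (A B : ob) (f : hom A B), f ⇒ id1 B ∘ f;
  lunitK : forall (A B : ob) (f : hom A B), lunit_inv f ∙ lunit f = id2 _;
  lunit_invK : forall (A B : ob) (f : hom A B), lunit f ∙ lunit_inv f = id2 _;
  lunit_natural : forall (A B : ob) (f f' : hom A B) (α : f ⇒ f'),
      lunit f' ∙ (id2 (id1 B) ⋆ α) = α ∙ lunit f;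

  runit : forall (A B : ob) (f : hom A B), f ∘ id1 A ⇒ f;
  runit_inv : forall (A B : ob) (f : hom A B), f ⇒ f ∘ id1 A;
  runitK : forall (A B : ob) (f : hom A B), runit_inv f ∙ runit f = id2 _;
  runit_invK : forall (A B : ob) (f : hom A B), runit f ∙ runit_inv f = id2 _;
  runit_natural : forall (A B : ob) (f f' : hom A B) (α : f ⇒ f'),
      runit f' ∙ (α ⋆ id2 (id1 A)) = α ∙ runit f;

  pentagon : forall (A B C D E : ob) (k : hom D E) (h : hom C D)
      (g : hom B C) (f : hom A B),
      assoc k h (g ∘ f) ∙ assoc (k ∘ h) g f
      = (id2 k ⋆ assoc h g f) ∙ assoc k (h ∘ g) f ∙ (assoc k h g ⋆ id2 f);
  triangle : forall (A B C : ob) (g : hom B C) (f : hom A B),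
      (id2 g ⋆ lunit f) ∙ assoc g (id1 B) f = runit g ⋆ id2 f
}.

Arguments hom {b} A B.
Arguments cell {b A B} f g.
Arguments id2 {b A B} f.
Arguments id1 {b} A.

Notation "f ⇒ g" := (cell f g) : bicat_scope.
Notation "β ∙ α" := (vcomp β α) : bicat_scope.
Notation "g ∘ f" := (comp g f) : bicat_scope.
Notation "β ⋆ α" := (hcomp β α) : bicat_scope.

Definition whisker_l (B : bicategory) (X Y Z : B) (g : hom Y Z)
    (f f' : hom X Y) (α : f ⇒ f') : g ∘ f ⇒ g ∘ f' := id2 g ⋆ α.

Definition whisker_r (B : bicategory) (X Y Z : B) (g g' : hom Y Z)
    (α : g ⇒ g') (f : hom X Y) : g ∘ f ⇒ g' ∘ f := α ⋆ id2 f.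

Notation "g ◁ α" := (whisker_l g α)
  (at level 40, left associativity) : bicat_scope.
Notation "α ▷ f" := (whisker_r α f)
  (at level 40, left associativity) : bicat_scope.

Definition invertible (B : bicategory) (X Y : B) (f g : hom X Y) (α : f ⇒ g) :
    Prop :=
  exists α' : g ⇒ f, α' ∙ α = id2 f /\ α ∙ α' = id2 g.

Definition arrow_class (B : bicategory) : Type :=
  forall X Y : B, hom X Y -> Prop.

Section Conditions.
Variables (B : bicategory) (W : arrow_class B).

Definition has_identities : Prop := forall A : B, W (id1 A).

Definition closed_comp : Prop :=
  forall (X Y Z : B) (g : hom Y Z) (f : hom X Y), W g -> W f -> W (g ∘ f).

Definition closed_iso : Prop :=
  forall (X Y : B) (f g : hom X Y) (α : f ⇒ g), invertible α -> W f -> W g.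

Definition wide_subcategory : Prop := has_identities /\ closed_comp.

Definition WB1 : Prop := has_identities.

(** The bracketing of [w ∘ v ∘ u] is immaterial in the presence of [WB5]. *)
Definition WB2 : Prop :=
  forall (X C D : B) (v : hom X C) (w : hom C D), W v -> W w ->
  exists (A : B) (u : hom A X), W (w ∘ v ∘ u).

Definition WB3 : Prop :=
  forall (A X C : B) (w : hom A X) (f : hom C X), W w ->
  exists (D : B) (h : hom D A) (v : hom D C),
    W v /\ exists α : w ∘ h ⇒ f ∘ v, invertible α.

(** [α u = w β], with the associativity constraints made explicit. *)
Definition lifts (X Y Z D : B) (w : hom Y Z) (f g : hom X Y)
    (α : w ∘ f ⇒ w ∘ g) (u : hom D X) (β : f ∘ u ⇒ g ∘ u) : Prop :=
  assoc w g u ∙ (α ▷ u) = (w ◁ β) ∙ assoc w f u.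

(** [(g ε)(β₁ s) = (β₂ t)(f ε)], with the associativity constraints made
    explicit. *)
Definition lifts_compat (X Y D1 D2 E : B) (f g : hom X Y)
    (u1 : hom D1 X) (β1 : f ∘ u1 ⇒ g ∘ u1)
    (u2 : hom D2 X) (β2 : f ∘ u2 ⇒ g ∘ u2)
    (s : hom E D1) (t : hom E D2) (ε : u1 ∘ s ⇒ u2 ∘ t) : Prop :=
  (g ◁ ε) ∙ assoc g u1 s ∙ (β1 ▷ s)
  = assoc g u2 t ∙ (β2 ▷ t) ∙ assoc_inv f u2 t ∙ (f ◁ ε) ∙ assoc f u1 s.

Definition WB4 : Prop :=
  forall (X Y Z : B) (w : hom Y Z) (f g : hom X Y) (α : w ∘ f ⇒ w ∘ g), W w ->
  (exists (D : B) (u : hom D X) (β : f ∘ u ⇒ g ∘ u), W u /\ lifts α β)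
  /\
  (forall (D1 D2 : B) (u1 : hom D1 X) (β1 : f ∘ u1 ⇒ g ∘ u1)
      (u2 : hom D2 X) (β2 : f ∘ u2 ⇒ g ∘ u2),
    W u1 -> lifts α β1 -> W u2 -> lifts α β2 ->
    exists (E : B) (s : hom E D1) (t : hom E D2) (ε : u1 ∘ s ⇒ u2 ∘ t),
      W (u1 ∘ s) /\ W (u2 ∘ t) /\ invertible ε /\ lifts_compat β1 β2 ε).

Definition WB5 : Prop :=
  forall (X Y : B) (v w : hom X Y) (α : v ⇒ w), invertible α -> W w -> W v.

Record satisfies_WB : Prop := {
  wb1 : WB1; wb2 : WB2; wb3 : WB3; wb4 : WB4; wb5 : WB5
}.

Definition BF1 : Prop := has_identities.

Definition BF2 : Prop := closed_comp.

Definition BF3 : Prop := WB3.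

Definition BF4 : Prop :=
  WB4 /\
  (forall (X Y Z : B) (w : hom Y Z) (f g : hom X Y) (α : w ∘ f ⇒ w ∘ g),
    W w -> invertible α ->
    exists (D : B) (u : hom D X) (β : f ∘ u ⇒ g ∘ u),
      W u /\ lifts α β /\ invertible β).

Definition BF5 : Prop := WB5.

Record satisfies_BF : Prop := {
  bf1 : BF1; bf2 : BF2; bf3 : BF3; bf4 : BF4; bf5 : BF5
}.

Inductive closure : arrow_class B :=
| closure_base (X Y : B) (f : hom X Y) : W f -> closure f
| closure_comp (X Y Z : B) (g : hom Y Z) (f : hom X Y) :
    closure g -> closure f -> closure (g ∘ f)
| closure_iso (X Y : B) (f g : hom X Y) (α : f ⇒ g) :
    invertible α -> closure f -> closure g.

End Conditions.

Lemma closure_smallest (B : bicategory) (W V : arrow_class B) :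
  (forall (X Y : B) (f : hom X Y), W X Y f -> V X Y f) ->
  closed_comp V -> closed_iso V ->
  forall (X Y : B) (f : hom X Y), closure W f -> V X Y f.
Proof.
intros HW Hc Hi X Y f Hf.
induction Hf as [X Y f Hf | X Y Z g f _ IHg _ IHf | X Y f g α Hα _ IHf].
- exact (HW _ _ _ Hf).
- exact (Hc _ _ _ _ _ IHg IHf).
- exact (Hi _ _ _ _ α Hα IHf).
Qed.

(* Main.v *)
(** Every arrow of the closure lands in [W] after a suitable precomposition,
    which gives [BF3].  Call [w] locally full if each [α : w f ⇒ w g] lifts
    along [w] after restriction along some arrow of the closure, and locally
    faithful if [w β = w γ] forces [β u = γ u] for some [u] in the closure.
    Both properties hold on [W] by [WB4] and are stable under composition and
    invertible 2-cells, hence hold on the closure.  Two lifts [(u1, β1)] and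
    [(u2, β2)] of the same 2-cell are compared by filling the cospan [u1], [u2]
    with [BF3] and equalising the two resulting 2-cells by local faithfulness;
    the lift of an invertible [α] is inverted by a lift of [α^-1], the two
    composites becoming identities after further restriction. *)

From Corelib Require Import ssreflect.
Require Import Defs.

Set Implicit Arguments.
Unset Strict Implicit.
Unset Printing Implicit Defensive.

Local Open Scope bicat_scope.

(** * Calculus of invertible 2-cells, whiskering and restriction *)

Section Whiskering.
Variable B : bicategory.

Lemma vcompK (X Y : B) (f g h : hom X Y) (β : g ⇒ f) (α : f ⇒ g) (γ : h ⇒ f) :
  β ∙ α = id2 f -> β ∙ (α ∙ γ) = γ.
Proof. by move=> E; rewrite -vcomp_assoc E vcomp_id_l. Qed.

Lemma vcomp_cancel_l (X Y : B) (f g h : hom X Y) (α : g ⇒ h) (β γ : f ⇒ g) :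
  invertible α -> α ∙ β = α ∙ γ -> β = γ.
Proof.
move=> [α' [E _]] H.
by rewrite -(vcompK β E) H vcompK.
Qed.

Lemma vcomp_cancel_r (X Y : B) (f g h : hom X Y) (α : f ⇒ g) (β γ : g ⇒ h) :
  invertible α -> β ∙ α = γ ∙ α -> β = γ.
Proof.
move=> [α' [_ E]] H.
by rewrite -(vcomp_id_r β) -E -vcomp_assoc H vcomp_assoc E vcomp_id_r.
Qed.

Lemma invertible_vcomp (X Y : B) (f g h : hom X Y) (β : g ⇒ h) (α : f ⇒ g) :
  invertible β -> invertible α -> invertible (β ∙ α).
Proof.
move=> [β' [Eβ Eβ']] [α' [Eα Eα']]; exists (α' ∙ β').
by rewrite !vcomp_assoc !vcompK.
Qed.

Lemma invertible_inv (X Y : B) (f g : hom X Y) (α : f ⇒ g) :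
  invertible α -> exists α' : g ⇒ f, invertible α'.
Proof. by move=> [α' [E E']]; exists α', α. Qed.

Lemma invertible_assoc (X Y Z T : B) (h : hom Z T) (g : hom Y Z) (f : hom X Y) :
  invertible (assoc h g f).
Proof. by exists (assoc_inv h g f); rewrite assocK assoc_invK. Qed.

Lemma invertible_assoc_inv (X Y Z T : B) (h : hom Z T) (g : hom Y Z)
  (f : hom X Y) : invertible (assoc_inv h g f).
Proof. by exists (assoc h g f); rewrite assocK assoc_invK. Qed.

Lemma invertible_runit (X Y : B) (f : hom X Y) : invertible (runit f).
Proof. by exists (runit_inv f); rewrite runitK runit_invK. Qed.

Lemma whisker_l_id (X Y Z : B) (g : hom Y Z) (f : hom X Y) :
  g ◁ id2 f = id2 (g ∘ f).
Proof. exact: hcomp_id. Qed.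

Lemma whisker_r_id (X Y Z : B) (g : hom Y Z) (f : hom X Y) :
  id2 g ▷ f = id2 (g ∘ f).
Proof. exact: hcomp_id. Qed.

Lemma whisker_l_vcomp (X Y Z : B) (k : hom Y Z) (f g h : hom X Y)
  (β : g ⇒ h) (α : f ⇒ g) : k ◁ (β ∙ α) = (k ◁ β) ∙ (k ◁ α).
Proof. by rewrite /whisker_l -interchange vcomp_id_l. Qed.

Lemma whisker_r_vcomp (X Y Z : B) (k : hom X Y) (f g h : hom Y Z)
  (β : g ⇒ h) (α : f ⇒ g) : (β ∙ α) ▷ k = (β ▷ k) ∙ (α ▷ k).
Proof. by rewrite /whisker_r -interchange vcomp_id_l. Qed.

Lemma whisker_lK (X Y Z : B) (k : hom Y Z) (f g : hom X Y) (β : g ⇒ f)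
  (α : f ⇒ g) : β ∙ α = id2 f -> (k ◁ β) ∙ (k ◁ α) = id2 (k ∘ f).
Proof. by move=> E; rewrite -whisker_l_vcomp E whisker_l_id. Qed.

Lemma whisker_rK (X Y Z : B) (k : hom X Y) (f g : hom Y Z) (β : g ⇒ f)
  (α : f ⇒ g) : β ∙ α = id2 f -> (β ▷ k) ∙ (α ▷ k) = id2 (f ∘ k).
Proof. by move=> E; rewrite -whisker_r_vcomp E whisker_r_id. Qed.

Lemma invertible_whisker_l (X Y Z : B) (k : hom Y Z) (f g : hom X Y)
  (α : f ⇒ g) : invertible α -> invertible (k ◁ α).
Proof. by move=> [α' [E E']]; exists (k ◁ α'); rewrite !whisker_lK. Qed.

Lemma invertible_whisker_r (X Y Z : B) (k : hom X Y) (f g : hom Y Z)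
  (α : f ⇒ g) : invertible α -> invertible (α ▷ k).
Proof. by move=> [α' [E E']]; exists (α' ▷ k); rewrite !whisker_rK. Qed.

Lemma whisker_exchange (X Y Z : B) (g g' : hom Y Z) (f f' : hom X Y)
  (β : g ⇒ g') (α : f ⇒ f') : (g' ◁ α) ∙ (β ▷ f) = (β ▷ f') ∙ (g ◁ α).
Proof.
by rewrite /whisker_l /whisker_r -!interchange !vcomp_id_l !vcomp_id_r.
Qed.

(** Conjugation by associators, so that lifting along [h ∘ g] can be treated one factor at a time.
    The restriction [restr α u] below is the special case [reassoc (α ▷ u)]. *)
Definition reassoc (X Y Z T : B) (h h' : hom Z T) (g g' : hom Y Z)
    (f f' : hom X Y) (α : (h ∘ g) ∘ f ⇒ (h' ∘ g') ∘ f') :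
    h ∘ (g ∘ f) ⇒ h' ∘ (g' ∘ f') :=
  assoc h' g' f' ∙ α ∙ assoc_inv h g f.

(** For [α : w f ⇒ w g] this is the paper's [α u]. *)
Definition restr (X Y Z Z' D : B) (a : hom Y Z) (f : hom X Y) (b : hom Z' Z)
    (g : hom X Z') (α : a ∘ f ⇒ b ∘ g) (u : hom D X) :
    a ∘ (f ∘ u) ⇒ b ∘ (g ∘ u) :=
  assoc b g u ∙ (α ▷ u) ∙ assoc_inv a f u.

Lemma reassoc_inj (X Y Z T : B) (h h' : hom Z T) (g g' : hom Y Z)
    (f f' : hom X Y) (α β : (h ∘ g) ∘ f ⇒ (h' ∘ g') ∘ f') :
  reassoc α = reassoc β -> α = β.
Proof.
move=> /(vcomp_cancel_r (invertible_assoc_inv _ _ _)).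
exact: (vcomp_cancel_l (invertible_assoc _ _ _)).
Qed.

Lemma reassoc_whisker_l (X Y Z T : B) (h : hom Z T) (g : hom Y Z)
    (f f' : hom X Y) (α : f ⇒ f') :
  reassoc ((h ∘ g) ◁ α) = h ◁ (g ◁ α).
Proof.
by rewrite /reassoc /whisker_l -hcomp_id assoc_natural vcomp_assoc assoc_invK
  vcomp_id_r.
Qed.

Lemma restr_id (X Y Z D : B) (a : hom Y Z) (f : hom X Y) (u : hom D X) :
  restr (id2 (a ∘ f)) u = id2 _.
Proof. by rewrite /restr whisker_r_id vcomp_id_r assoc_invK. Qed.

Lemma restr_vcomp (X Y Y' Y'' Z D : B) (a : hom Y Z) (f : hom X Y)
    (b : hom Y' Z) (g : hom X Y') (c : hom Y'' Z) (h : hom X Y'')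
    (β : b ∘ g ⇒ c ∘ h) (α : a ∘ f ⇒ b ∘ g) (u : hom D X) :
  restr (β ∙ α) u = restr β u ∙ restr α u.
Proof.
by rewrite /restr whisker_r_vcomp !vcomp_assoc (vcompK _ (assocK _ _ _)).
Qed.

Lemma restr_whisker_l (X Y Z D : B) (a : hom Y Z) (f g : hom X Y)
    (α : f ⇒ g) (u : hom D X) : restr (a ◁ α) u = a ◁ (α ▷ u).
Proof.
by rewrite /restr /whisker_l /whisker_r assoc_natural vcomp_assoc assoc_invK
  vcomp_id_r.
Qed.

Lemma whisker_l_restr (X Y Y' Z Z' D : B) (k : hom Z Z') (a : hom Y Z)
    (f : hom X Y) (b : hom Y' Z) (g : hom X Y') (α : a ∘ f ⇒ b ∘ g)
    (u : hom D X) :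
  k ◁ restr α u
  = (k ◁ assoc b g u) ∙ restr (k ◁ α) u ∙ (k ◁ assoc_inv a f u).
Proof. by rewrite restr_whisker_l -!whisker_l_vcomp. Qed.

Lemma restr_whisker_r (X Y Z D : B) (a b : hom Y Z) (f : hom X Y)
    (α : a ⇒ b) (u : hom D X) : restr (α ▷ f) u = α ▷ (f ∘ u).
Proof.
by rewrite /restr /whisker_r assoc_natural vcomp_assoc assoc_invK vcomp_id_r
  hcomp_id.
Qed.

(** This is the interchange of [α] and [ε], conjugated by associators. *)
Lemma restr_natural (X Y Y' Z D : B) (a : hom Y Z) (f : hom X Y)
    (b : hom Y' Z) (g : hom X Y') (α : a ∘ f ⇒ b ∘ g) (u v : hom D X)
    (ε : u ⇒ v) :
  (b ◁ (g ◁ ε)) ∙ restr α u = restr α v ∙ (a ◁ (f ◁ ε)).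
Proof.
rewrite -!reassoc_whisker_l /restr /reassoc !vcomp_assoc.
rewrite !(vcompK _ (assocK _ _ _)).
rewrite -(vcomp_assoc (_ ◁ ε)) whisker_exchange.
by rewrite !vcomp_assoc.
Qed.

Lemma pentagon_assoc_inv (X Y Z T U : B) (k : hom T U) (h : hom Z T)
    (g : hom Y Z) (f : hom X Y) :
  assoc_inv (k ∘ h) g f ∙ assoc_inv k h (g ∘ f)
  = (assoc_inv k h g ▷ f) ∙ assoc_inv k (h ∘ g) f ∙ (k ◁ assoc_inv h g f).
Proof.
apply: (vcomp_cancel_r (invertible_assoc _ _ _)).
rewrite vcomp_assoc assocK vcomp_id_r.
apply: (vcomp_cancel_r (invertible_assoc _ _ _)).
rewrite assocK !vcomp_assoc pentagon -/(whisker_l _ _) -/(whisker_r _ _).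
rewrite vcomp_assoc (vcompK _ (whisker_lK _ (assocK _ _ _))).
by rewrite (vcompK _ (assocK _ _ _)) (whisker_rK _ (assocK _ _ _)).
Qed.

(** The pentagon rearranges the associators on the target side, its inverse form those on the source
    side; in the middle, naturality of [assoc] splits [α ▷ (u ∘ v)]. *)
Lemma restr_comp (X Y Y' Z D E : B) (a : hom Y Z) (f : hom X Y)
    (b : hom Y' Z) (g : hom X Y') (α : a ∘ f ⇒ b ∘ g)
    (u : hom D X) (v : hom E D) :
  restr α (u ∘ v)
  = (b ◁ assoc g u v) ∙ restr (restr α u) v ∙ (a ◁ assoc_inv f u v).
Proof.
rewrite {2 3}/restr !whisker_r_vcomp !vcomp_assoc.
have:= pentagon_assoc_inv a f u v; rewrite vcomp_assoc => <-.
have:= pentagon b g u v; rewrite -/(whisker_l _ _) -/(whisker_r _ _) vcomp_assoc.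
move=> P; rewrite -(vcomp_assoc (assoc b _ v)) -(vcomp_assoc (b ◁ _)) -P.
by rewrite /restr -(restr_whisker_r _ α) /restr !vcomp_assoc.
Qed.

Lemma restr_reassoc (X Y Z T D : B) (w2 : hom Z T) (w1 : hom Y Z)
    (f g : hom X Y) (α : (w2 ∘ w1) ∘ f ⇒ (w2 ∘ w1) ∘ g) (u : hom D X) :
  reassoc (restr α u)
  = (w2 ◁ assoc w1 g u) ∙ restr (reassoc α) u ∙ (w2 ◁ assoc_inv w1 f u).
Proof.
rewrite /restr /reassoc !whisker_r_vcomp !vcomp_assoc.
have:= pentagon_assoc_inv w2 w1 f u; rewrite vcomp_assoc => <-.
have:= pentagon w2 w1 g u; rewrite -/(whisker_l _ _) -/(whisker_r _ _) vcomp_assoc.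
move=> P; rewrite -(vcomp_assoc (assoc w2 _ u)) -(vcomp_assoc (w2 ◁ _)) -P.
by rewrite !vcomp_assoc.
Qed.

(** Moving the associators to one side turns lifting into an equation that can be rewritten with. *)
Lemma liftsE (X Y Z D : B) (w : hom Y Z) (f g : hom X Y)
    (α : w ∘ f ⇒ w ∘ g) (u : hom D X) (β : f ∘ u ⇒ g ∘ u) :
  lifts α β <-> restr α u = w ◁ β.
Proof.
rewrite /lifts /restr; split=> [-> | <-].
- by rewrite vcomp_assoc assoc_invK vcomp_id_r.
- by rewrite vcomp_assoc assocK vcomp_id_r.
Qed.

Lemma lifts_compatE (X Y D1 D2 E : B) (f g : hom X Y)
    (u1 : hom D1 X) (β1 : f ∘ u1 ⇒ g ∘ u1)
    (u2 : hom D2 X) (β2 : f ∘ u2 ⇒ g ∘ u2)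
    (s : hom E D1) (t : hom E D2) (ε : u1 ∘ s ⇒ u2 ∘ t) :
  lifts_compat β1 β2 ε
  <-> (g ◁ ε) ∙ restr β1 s = restr β2 t ∙ (f ◁ ε).
Proof.
rewrite /lifts_compat /restr; split=> H.
- by rewrite -!vcomp_assoc H !vcomp_assoc assoc_invK vcomp_id_r.
- by rewrite -H !vcomp_assoc assocK vcomp_id_r.
Qed.

(** Allows a lift to be refined along any further arrow, in particular to equalise or invert it. *)
Lemma lifts_restr (X Y Z D E : B) (w : hom Y Z) (f g : hom X Y)
    (α : w ∘ f ⇒ w ∘ g) (u : hom D X) (β : f ∘ u ⇒ g ∘ u) (v : hom E D) :
  lifts α β -> lifts α (restr β v).
Proof.
move=> /liftsE H; apply/liftsE.
by rewrite restr_comp H whisker_l_restr.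
Qed.

Lemma whisker_r_comp (X Y Z D : B) (f g : hom Y Z) (α : f ⇒ g) (u : hom X Y)
    (v : hom D X) :
  α ▷ (u ∘ v) = assoc g u v ∙ ((α ▷ u) ▷ v) ∙ assoc_inv f u v.
Proof. by rewrite -restr_whisker_r. Qed.

Lemma invertible_restr (X Y Y' Z D : B) (a : hom Y Z) (f : hom X Y)
    (b : hom Y' Z) (g : hom X Y') (α : a ∘ f ⇒ b ∘ g) (u : hom D X) :
  invertible (α ▷ u) -> invertible (restr α u).
Proof.
move=> H; apply: invertible_vcomp (invertible_assoc_inv _ _ _).
exact: invertible_vcomp (invertible_assoc _ _ _) H.
Qed.

End Whiskering.

(** * Stability of local fullness and local faithfulness *)

Section Closure.
Variables (B : bicategory) (W : arrow_class B).

(** The arrow [u] is sought in [closure W] rather than in [W], since successive restrictions must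
    compose. *)
Definition locally_full (X Y : B) (w : hom X Y) : Prop :=
  forall (T : B) (f g : hom T X) (α : w ∘ f ⇒ w ∘ g),
  exists (D : B) (u : hom D T) (β : f ∘ u ⇒ g ∘ u),
    closure W u /\ lifts α β.

Definition locally_faithful (X Y : B) (w : hom X Y) : Prop :=
  forall (T : B) (f g : hom T X) (β γ : f ⇒ g), w ◁ β = w ◁ γ ->
  exists (D : B) (u : hom D T), closure W u /\ β ▷ u = γ ▷ u.

(** The 2-cell is lifted along [w2] first, and the resulting [β] along [w1]; the pentagon, through
    [restr_reassoc], matches the bracketings. *)
Lemma locally_full_comp (X Y Z : B) (w2 : hom Y Z) (w1 : hom X Y) :
  locally_full w2 -> locally_full w1 -> locally_full (w2 ∘ w1).
Proof.
move=> F2 F1 T f g α.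
have [D [u [β [Wu /liftsE Hβ]]]] := F2 _ _ _ (reassoc α).
have [E [v [γ [Wv /liftsE Hγ]]]] := F1 _ _ _ (reassoc β).
exists E, (u ∘ v), (reassoc γ); split; first exact: closure_comp.
have H : reassoc (restr α u) = w2 ◁ reassoc β.
  by rewrite restr_reassoc Hβ -!whisker_l_vcomp.
have {}H : restr (restr α u) v = (w2 ∘ w1) ◁ γ.
  apply: reassoc_inj; rewrite restr_reassoc H restr_whisker_l.
  by rewrite -!whisker_l_vcomp -/(restr _ _) Hγ reassoc_whisker_l.
by apply/liftsE; rewrite restr_comp H -!whisker_l_vcomp.
Qed.

Lemma locally_faithful_comp (X Y Z : B) (w2 : hom Y Z) (w1 : hom X Y) :
  locally_faithful w2 -> locally_faithful w1 -> locally_faithful (w2 ∘ w1).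
Proof.
move=> F2 F1 T f g β γ H.
have [|D [u [Wu Hu]]] := F2 _ _ _ (w1 ◁ β) (w1 ◁ γ).
  by rewrite -!reassoc_whisker_l H.
have [|E [v [Wv Hv]]] := F1 _ _ _ (β ▷ u) (γ ▷ u).
  by rewrite -!restr_whisker_l /restr Hu.
exists E, (u ∘ v); split; first exact: closure_comp.
by rewrite !whisker_r_comp Hv.
Qed.

(** Conjugating [α] by [θ] gives a 2-cell between composites with [w]; its lift also lifts [α],
    because [θ] slides past [β] by interchange. *)
Lemma locally_full_iso (X Y : B) (w w' : hom X Y) (θ : w ⇒ w') :
  invertible θ -> locally_full w -> locally_full w'.
Proof.
move=> [θ' [K K']] F T f g α.
have [D [u [β [Wu /liftsE H]]]] := F _ _ _ ((θ' ▷ g) ∙ α ∙ (θ ▷ f)).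
exists D, u, β; split=> //; apply/liftsE.
apply: (vcomp_cancel_r (α := θ ▷ (f ∘ u))).
  by apply: invertible_whisker_r; exists θ'.
rewrite whisker_exchange -H !restr_vcomp !restr_whisker_r vcomp_assoc.
by rewrite vcompK ?whisker_rK.
Qed.

Lemma locally_faithful_iso (X Y : B) (w w' : hom X Y) (θ : w ⇒ w') :
  invertible θ -> locally_faithful w -> locally_faithful w'.
Proof.
move=> iθ F T f g β γ H; apply: F.
apply: (vcomp_cancel_l (invertible_whisker_r _ iθ)).
by rewrite -!whisker_exchange H.
Qed.

(** * Transfer of the conditions from [W] to its closure *)

Hypothesis HW : satisfies_WB W.

Lemma WB_precomp_id (X Y : B) (f : hom X Y) : W f -> W (f ∘ id1 X).
Proof. by apply: (wb5 HW); apply: invertible_runit. Qed.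

(** Induction on the closure. For a composite, with [g ∘ v] and [f ∘ u] in [W], [WB3] fills the
    cospan of [v] and [f ∘ u], and [WB2] corrects the composite of [g ∘ v] with the new leg [k]. *)
Lemma closure_precomp (X Y : B) (f : hom X Y) :
  closure W f -> exists (D : B) (u : hom D X), W (f ∘ u).
Proof.
elim=> {X Y f} [X Y f Wf | X Y Z g f _ [D [v Wgv]] _ [E [u Wfu]]
  | X Y f g α iα _ [D [u Wfu]]].
- by exists X, (id1 X); apply: WB_precomp_id.
- have [F [h [k [Wk [α iα]]]]] := wb3 HW v Wfu.
  have [G [x Wx]] := wb2 HW Wk Wgv.
  exists G, (u ∘ (h ∘ x)).
  (* What remains is an invertible 2-cell from [(g ∘ f) ∘ (u ∘ (h ∘ x))] to [((g ∘ v) ∘ k) ∘ x]: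
     associators around [α]. *)
  apply: (wb5 HW) Wx.
  apply: (@invertible_vcomp _ _ _ _ ((g ∘ (v ∘ k)) ∘ x)).
    apply: invertible_whisker_r; apply: invertible_assoc_inv.
  apply: (invertible_vcomp (invertible_whisker_r x (invertible_whisker_l g iα))).
  apply: (@invertible_vcomp _ _ _ _ (g ∘ (((f ∘ u) ∘ h) ∘ x))).
    exact: invertible_assoc_inv.
  apply: (@invertible_vcomp _ _ _ _ (g ∘ ((f ∘ u) ∘ (h ∘ x)))).
    apply: invertible_whisker_l; exact: invertible_assoc_inv.
  apply: (@invertible_vcomp _ _ _ _ (g ∘ (f ∘ (u ∘ (h ∘ x))))).
    apply: invertible_whisker_l; exact: invertible_assoc_inv.
  exact: invertible_assoc.
- have [α' iα'] := invertible_inv iα.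
  by exists D, u; apply: (wb5 HW) (invertible_whisker_r u iα') Wfu.
Qed.

Lemma closure_has_identities : has_identities (closure W).
Proof. by move=> X; apply/closure_base/(wb1 HW). Qed.

Lemma closure_WB3 : WB3 (closure W).
Proof.
move=> X Y Z w f /closure_precomp [D [u Wwu]].
have [E [h [v [Wv [α iα]]]]] := wb3 HW f Wwu.
exists E, (u ∘ h), v; split; first exact: closure_base.
exists (α ∙ assoc_inv w u h).
exact: invertible_vcomp iα (invertible_assoc_inv _ _ _).
Qed.

Lemma closure_WB5 : WB5 (closure W).
Proof.
by move=> X Y v w α /invertible_inv [α' iα']; apply: closure_iso iα'.
Qed.

Lemma closure_locally_full (X Y : B) (w : hom X Y) :
  closure W w -> locally_full w.
Proof.
elim=> {X Y w} [X Y w Ww T f g α | X Y Z g f _ Fg _ Ff | X Y f g α iα _].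
- have [[D [u [β [Wu H]]]] _] := wb4 HW α Ww.
  by exists D, u, β; split=> //; apply: closure_base.
- exact: locally_full_comp.
- exact: locally_full_iso iα.
Qed.

(** Both [β] and [γ], restricted along an identity, lift the same 2-cell [w ◁ β]. The uniqueness
    half of [WB4] compares them through an invertible [ε], which interchange then allows to be
    cancelled. *)
Lemma W_locally_faithful (X Y : B) (w : hom X Y) : W w -> locally_faithful w.
Proof.
move=> Ww T f g β γ H.
have L δ : w ◁ δ = w ◁ β -> lifts (w ◁ β) (δ ▷ id1 T).
  by move=> E; apply/liftsE; rewrite -E restr_whisker_l.
have [_ U] := wb4 HW (w ◁ β) Ww.
have [E [s [t [ε [Ws [Wt [iε /lifts_compatE C]]]]]]] :=
  U _ _ _ _ _ _ (wb1 HW T) (L β eq_refl) (wb1 HW T) (L γ (eq_sym H)).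
exists E, (id1 T ∘ s); split; first exact: closure_base.
move: C; rewrite !restr_whisker_r -whisker_exchange.
exact: (vcomp_cancel_l (invertible_whisker_l _ iε)).
Qed.

Lemma closure_locally_faithful (X Y : B) (w : hom X Y) :
  closure W w -> locally_faithful w.
Proof.
elim=> {X Y w} [X Y w Ww | X Y Z g f _ Fg _ Ff | X Y f g α iα _].
- exact: W_locally_faithful.
- exact: locally_faithful_comp.
- exact: locally_faithful_iso iα.
Qed.

Lemma closure_WB4 : WB4 (closure W).
Proof.
move=> X Y Z w f g α Ww; split; first exact: closure_locally_full.
move=> D1 D2 u1 β1 u2 β2 Wu1 L1 Wu2 L2.
have [E [s [t [Wt [ε iε]]]]] := closure_WB3 u2 Wu1.
have [|F [v [Wv H]]] := closure_locally_faithful Ww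
  (β := (g ◁ ε) ∙ restr β1 s) (γ := restr β2 t ∙ (f ◁ ε)).
  (* Whiskering by [w] turns the restricted lifts into restrictions of [α], so the two sides agree
     by naturality in [ε]. *)
  rewrite (whisker_l_vcomp w (g ◁ ε)) (whisker_l_vcomp w (restr β2 t)).
  have/liftsE <- := lifts_restr s L1; have/liftsE <- := lifts_restr t L2.
  exact: restr_natural.
have iεv : invertible (restr ε v).
  by apply/invertible_restr/invertible_whisker_r.
have Wu2tv : closure W (u2 ∘ (t ∘ v)).
  exact: closure_comp Wu2 (closure_comp Wt Wv).
(* The filler gives membership only for [t]; that of [u1 ∘ (s ∘ v)] is transported along the
   invertible [restr ε v]. *)
exists F, (s ∘ v), (t ∘ v), (restr ε v); split; first exact: closure_WB5 iεv Wu2tv.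
do 2! split=> //; apply/lifts_compatE.
have {}H : restr (g ◁ ε) v ∙ restr (restr β1 s) v
    = restr (restr β2 t) v ∙ restr (f ◁ ε) v.
  by rewrite -!restr_vcomp /restr H.
rewrite (restr_comp β1) (restr_comp β2) !whisker_l_restr.
move: (restr (g ◁ ε) v) (restr (f ◁ ε) v) (restr (restr β1 s) v)
  (restr (restr β2 t) v) H => ρg ρf ρ1 ρ2 H.
rewrite !vcomp_assoc !(vcompK _ (whisker_lK _ (assocK _ _ _))).
by rewrite -(vcomp_assoc ρg) H !vcomp_assoc.
Qed.

Lemma closure_lift_invertible (X Y Z : B) (w : hom Y Z) (f g : hom X Y)
    (α : w ∘ f ⇒ w ∘ g) :
  closure W w -> invertible α ->
  exists (D : B) (u : hom D X) (β : f ∘ u ⇒ g ∘ u),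
    closure W u /\ lifts α β /\ invertible β.
Proof.
move=> Ww [α' [K K']].
have [D [u [β [Wu Lβ]]]] := closure_locally_full Ww α.
(* The inverse is first restricted along [u], so that [β'] is composable with [β ▷ v] on both
   sides. *)
have [E [v [β' [Wv Lβ']]]] := closure_locally_full Ww (restr α' u).
have /liftsE Hβ := Lβ; have /liftsE Hβ' := Lβ'.
have Eβ : w ◁ (β ▷ v) = restr (restr α u) v by rewrite Hβ restr_whisker_l.
have [|F [x [Wx Hx]]] := closure_locally_faithful Ww
  (β := β' ∙ (β ▷ v)) (γ := id2 _).
  by rewrite whisker_l_vcomp Eβ -Hβ' -!restr_vcomp K !restr_id whisker_l_id.
(* The second composite is equalised only after restriction along [x], so that [x ∘ y] serves both
   composites. *)
have [|G [y [Wy Hy]]] := closure_locally_faithful Ww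
  (β := ((β ▷ v) ∙ β') ▷ x) (γ := id2 _).
  rewrite -restr_whisker_l whisker_l_vcomp Eβ -Hβ' -!restr_vcomp K' !restr_id.
  by rewrite whisker_l_id.
exists G, (u ∘ (v ∘ (x ∘ y))), (restr β (v ∘ (x ∘ y))).
split; first exact: closure_comp Wu (closure_comp Wv (closure_comp Wx Wy)).
split; first exact: lifts_restr.
(* Peeling off associators reduces the goal to invertibility of [((β ▷ v) ▷ x) ▷ y]. *)
apply: invertible_restr; rewrite -restr_whisker_r; apply: invertible_restr.
rewrite -restr_whisker_r; apply: invertible_restr.
exists ((β' ▷ x) ▷ y); rewrite -!whisker_r_vcomp Hx Hy.
by rewrite !whisker_r_id.
Qed.

End Closure.

Theorem lemma4p10 (B : bicategory) (W : arrow_class B) (HW : satisfies_WB W) :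
  wide_subcategory (closure W) /\ satisfies_BF (closure W).
Proof.
have C : closed_comp (closure W) by move=> X Y Z g f; apply: closure_comp.
split; first by split=> //; apply: closure_has_identities.
split=> //.
- exact: closure_has_identities.
- exact: closure_WB3.
- split; first exact: closure_WB4.
  by move=> X Y Z w f g α; apply: closure_lift_invertible.
- exact: closure_WB5.
Qed.
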